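(* Let $\mathcal{H}_1,\mathcal{H}_2$ be real Hilbert spaces, let $g\colon\mathcal{H}_1\to(-\infty,+\infty]$ and $f\colon\mathcal{H}_2\to(-\infty,+\infty]$ be proper convex lower semicontinuous functions, and let $K\colon\mathcal{H}_1\to\mathcal{H}_2$ be a bounded linear operator with norm $\|K\|$ such that the solution set of the saddle point problem $$\min_{u\in\mathcal{H}_1}\max_{v\in\mathcal{H}_2}\; g(u)+\langle Ku,v\rangle-f^*(v)$$ is nonempty. Let $\tau,\sigma>0$ satisfy $\tau\sigma\|K\|^2<1$, let $u_0\in\mathcal{H}_1$ and let $v_0\in\mathcal{H}_2$. Then the sequence $(u_k,v_k)$ generated by $$u_{k+1}=\operatorname{prox}_{\tau g}(u_k-\tau K^*v_k),\qquad v_{k+1}=\operatorname{prox}_{\sigma f^*}(v_k+\sigma Ku_{k+1})+\sigma(Ku_{k+1}-Ku_k),\qquad k=0,1,2,\dots,$$ converges weakly to a solution of this saddle point problem.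
   Context: Here $f^*$ is the Fenchel conjugate of $f$, $K^*$ is the adjoint of $K$, and for a proper convex lower semicontinuous function $h$ and $\gamma>0$, $\operatorname{prox}_{\gamma h}(w)=\operatorname{argmin}_{p}\{h(p)+\frac{1}{2\gamma}\|p-w\|^2\}=(\mathrm{Id}+\gamma\,\partial h)^{-1}(w)$. A solution of the saddle point problem is a saddle point, i.e. a pair $(u,v)$ with $g(u)<+\infty$, $f^*(v)<+\infty$ and $g(u)+\langle Ku,v'\rangle-f^*(v')\le g(u)+\langle Ku,v\rangle-f^*(v)\le g(u')+\langle Ku',v\rangle-f^*(v)$ for all $(u',v')\in\mathcal{H}_1\times\mathcal{H}_2$; equivalently, $-K^*v\in\partial g(u)$ and $Ku\in\partial f^*(v)$. *)

(* Defs.v *)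
(* MathComp-Analysis *)
From HB Require Import structures.
From mathcomp Require Import all_boot all_order all_algebra sesquilinear.
From mathcomp Require Import all_classical all_reals all_analysis.

Set Implicit Arguments.
Unset Strict Implicit.
Unset Printing Implicit Defensive.

Import Order.TTheory GRing.Theory Num.Theory.
Import numFieldNormedType.Exports.

Local Open Scope classical_set_scope.
Local Open Scope ring_scope.

HB.mixin Record CompleteNormedModule_isHilbert (R : realType) H
    of CompleteNormedModule R H := {
  inner : {dot H for @idfun R} ;
  sqr_norm_inner : forall x : H, `|x| ^+ 2 = inner x x }.

#[short(type="hilbertType")]
HB.structure Definition Hilbert (R : realType) :=
  { H of CompleteNormedModule_isHilbert R H & CompleteNormedModule R H }.

Arguments inner {R s}.

Section operators.
Context {R : realType} {H1 H2 : hilbertType R}.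

(* A real number only when [K] is bounded: [sup] is 0 on unbounded sets. *)
Definition opnorm (K : H1 -> H2) : R :=
  sup [set `|K x| | x in [set x : H1 | `|x| <= 1]].

(* The default value 0 is not used when [K] is linear and bounded. *)
Definition adjoint (K : H1 -> H2) (v : H2) : H1 :=
  xget 0 [set w : H1 | forall x : H1, inner (K x) v = inner x w].

End operators.

Section convex_analysis.
Context {R : realType} {H : hilbertType R}.
Local Open Scope ereal_scope.

Definition proper_ereal (h : H -> \bar R) : Prop :=
  (forall x, h x != -oo) /\ (exists x, h x < +oo).

Definition convex_ereal (h : H -> \bar R) : Prop :=
  forall (x y : H) (t : R), (0 < t < 1)%R ->
    h (t *: x + (1 - t) *: y)%R <= t%:E * h x + (1 - t)%R%:E * h y.

Definition fenchel (h : H -> \bar R) (v : H) : \bar R :=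
  ereal_sup [set (inner v x)%:E - h x | x in [set: H]].

Definition is_argmin (F : H -> \bar R) (p : H) : Prop := forall q, F p <= F q.

(* The default value 0 is not used when [h] is proper, convex and lower
   semicontinuous and [0 < gamma]: the minimizer then exists and is unique. *)
Definition prox (gamma : R) (h : H -> \bar R) (w : H) : H :=
  xget 0%R
    [set p | is_argmin (fun q => h q + ((2 * gamma)^-1 * `|q - w| ^+ 2)%R%:E) p].

End convex_analysis.

Section saddle.
Context {R : realType} {H1 H2 : hilbertType R}.
Local Open Scope ereal_scope.

Definition lagrangian (g : H1 -> \bar R) (f : H2 -> \bar R) (K : H1 -> H2)
    (u : H1) (v : H2) : \bar R :=
  g u + (inner (K u) v)%:E - fenchel f v.

Definition is_saddle (g : H1 -> \bar R) (f : H2 -> \bar R) (K : H1 -> H2)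
    (u : H1) (v : H2) : Prop :=
  [/\ g u < +oo, fenchel f v < +oo &
    forall u' v', lagrangian g f K u v' <= lagrangian g f K u v
                  /\ lagrangian g f K u v <= lagrangian g f K u' v].

End saddle.

(* Convergence against the topological dual, so that it also applies to the
   product [H1 * H2], whose topology does not depend on which of the equivalent
   product norms (here the maximum) is used. *)
Definition weakly_cvg {R : realType} {E : normedModType R}
    (x : nat -> E) (l : E) : Prop :=
  forall phi : {linear E -> R^o}, continuous phi ->
    (fun k => phi (x k)) @ \oo --> phi l.

(* Main.v *)
Require Import Defs.
From HB Require Import structures.
From mathcomp Require Import all_boot all_order all_algebra sesquilinear.
From mathcomp Require Import all_classical all_reals all_analysis.
From mathcomp Require Import ring lra.
Set Implicit Arguments.
Unset Strict Implicit.
Unset Printing Implicit Defensive.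
Import Order.TTheory GRing.Theory Num.Theory.
Import numFieldNormedType.Exports.
Local Open Scope classical_set_scope.
Local Open Scope ring_scope.

(** One step of the algorithm is the map
      [pd_step (u, v) = (u+, y + sigma (K u+ - K u))]
    with [u+ = prox_(tau g) (u - tau K^* v)] and
    [y = prox_(sigma f^* ) (v + sigma K u+)].  In the metric
      [|u|^2 / tau + |v - sigma K u|^2 / sigma]
    ([pd_form]) this map is averaged: adding the monotonicity inequalities of
    the subdifferentials of [g] and of [f^*] at the proximal points of two steps
    bounds the growth of the metric by
      [- |du|^2 / tau + sigma |K du|^2 - |dv - 2 sigma K du|^2 / sigma],
    where [(du, dv)] is the difference of the two displacements
    ([pd_step_descent]), and [tau sigma |K|^2 < 1] makes that bound negative
    definite ([pd_step_averaged]).  The fixed points of [pd_step] are exactly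
    the saddle points ([pd_step_fixed], [saddle_subgradients]).

    The rest is the weak convergence of the iterates of an averaged map with a
    fixed point, proved in [averaged_iterates_dot_cvg] for any positive definite
    form whose bounded sequences have weak limits along ultrafilters.
    The distance to each fixed point decreases and the displacements vanish;
    by the expansion of squares, every weak limit of the iterates is a fixed
    point ([demiclosed]); and by Opial's argument there is only one such limit.
    Limits are taken along ultrafilters, where bounded real sequences always
    converge: weak compactness of balls ([bounded_weak_limit]) is then the Riesz
    representation of the pointwise limit of the functionals [inner (x k)].

    Everything specific to Hilbert spaces comes from one minimization result,
    [exists_argmin]: a convex lower semicontinuous function bounded below by
    [- C |q| - D] has a minimizer after adding a multiple of [|q - w|^2].  It
    gives the proximal map and its characterization by subgradients ([proxP]),
    and, for a continuous linear function, the Riesz representation, hence the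
    adjoint of [K].  The lower bounds that it asks of [g] and [f^*] are the
    affine minorants given by the subgradients at a saddle point
    ([subgradient_lower_bound]). *)

(** * Positive definite bilinear forms *)

Section dot_theory.
Context {R : realType} {E : lmodType R} (b : {dot E for @idfun R}).
Implicit Types x y z : E.

Lemma dotC x y : b x y = b y x.
Proof. by rewrite hermitian_subproof expr0 mul1r. Qed.

Lemma dotDl z x y : b (x + y) z = b x z + b y z.
Proof. exact: linearDl. Qed.

Lemma dotNl z x : b (- x) z = - b x z.
Proof. exact: linearNl. Qed.

Lemma dotZl z a x : b (a *: x) z = a * b x z.
Proof. exact: linearZl_LR. Qed.

Lemma dotDr z x y : b z (x + y) = b z x + b z y.
Proof. by rewrite dotC dotDl !(dotC z). Qed.

Lemma dotNr z x : b z (- x) = - b z x.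
Proof. by rewrite dotC dotNl (dotC z). Qed.

Lemma dotZr z a x : b z (a *: x) = a * b z x.
Proof. by rewrite dotC dotZl (dotC z). Qed.

Definition dotE := (dotDl, dotDr, dotNl, dotNr, dotZl, dotZr).

Lemma dot_ge0 x : 0 <= b x x.
Proof.
have [->|/neq0_dnorm_gt0/ltW//] := eqVneq x 0.
by rewrite linear0l.
Qed.

Lemma dot_le0_eq0 x : b x x <= 0 -> x = 0.
Proof.
have [->//|/neq0_dnorm_gt0 x0] := eqVneq x 0.
by rewrite leNgt x0.
Qed.

Lemma dot_CauchySchwarz x y : b x y ^+ 2 <= b x x * b y y.
Proof.
have [->|/neq0_dnorm_gt0 y0] := eqVneq y 0.
  have b0 a : b a 0 = 0 by exact: linear0r.
  by rewrite !b0 mulr0 expr0n.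
have := dot_ge0 (b y y *: x - b x y *: y).
have -> : b (b y y *: x - b x y *: y) (b y y *: x - b x y *: y) =
    b y y * (b x x * b y y - b x y ^+ 2).
  by rewrite !dotE (dotC y x); ring.
by rewrite pmulr_rge0// subr_ge0.
Qed.

End dot_theory.

(** * Limits along ultrafilters *)

(** If a neighbourhood [A] of [l] were not reached along [F], the complement of
    [f @^-1` A] could be added to [F], and an ultrafilter refining the result
    would contradict the hypothesis. *)
Lemma cvg_ultrafilters (T : Type) (X : topologicalType) (F : set_system T)
    (f : T -> X) (l : X) : ProperFilter F ->
  (forall U, UltraFilter U -> F `<=` U -> f @ U --> l) -> f @ F --> l.
Proof.
move=> FF Ul A lA; apply: contrapT => nFA.
pose G := filter_from F (fun B => B `&` ~` (f @^-1` A)).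
have GF : ProperFilter G.
  apply: filter_from_proper.
    apply: filter_from_filter; first by exists setT; exact: filterT.
    move=> B C FB FC; exists (B `&` C); first exact: filterI.
    by move=> k [[Bk Ck] nk].
  move=> B FB; apply: contrapT => /set0P/negP; rewrite negbK => /eqP B0.
  apply: nFA; apply: (filterS (P := B)) FB => k Bk; apply: contrapT => nAk.
  by have : (B `&` ~` (f @^-1` A)) k by []; rewrite B0.
have [U [UU GU]] := ultraFilterLemma GF.
have FU : F `<=` U.
  by move=> B FB; apply: GU; exists B => // k [].
have /(Ul U UU FU) : nbhs l A by [].
move=> UA; have {}UA : U (f @^-1` A) by []; have UnA : U (~` (f @^-1` A)).
  by apply: GU; exists setT => [|k []//]; exact: filterT.
have [k [Ak nAk]] := filter_ex (filterI UA UnA).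
exact: nAk.
Qed.

(** * Iterates of averaged maps *)

Section weak_convergence_of_iterations.
Context {R : realType} {E : lmodType R} (b : {dot E for @idfun R}).

Definition dot_cvg (F : set_system nat) (z : nat -> E) (l : E) : Prop :=
  forall y, (fun k => b (z k) y) @ F --> b l y.

Definition nonexpansive (T : E -> E) : Prop :=
  forall x y, b (T x - T y) (T x - T y) <= b (x - y) (x - y).

(** The usual [T = (1 - a) Id + a N] with [N] nonexpansive, in the equivalent
    form of an inequality with [kappa = (1 - a) / a]. *)
Definition averaged (kappa : R) (T : E -> E) : Prop := forall x y,
  b (T x - T y) (T x - T y)
  + kappa * b ((x - T x) - (y - T y)) ((x - T x) - (y - T y))
  <= b (x - y) (x - y).

Lemma averaged_nonexpansive kappa T : 0 < kappa -> averaged kappa T ->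
  nonexpansive T.
Proof.
move=> k0 Tav x y; apply: le_trans (Tav x y).
by rewrite lerDl mulr_ge0 ?dot_ge0// ltW.
Qed.

(** With [d = l - T l], nonexpansiveness gives
    [|z - T l|^2 <= |z - l|^2] up to a term controlled by [z - T z], while weak
    convergence gives [|z - T l|^2 = |z - l|^2 + |d|^2] in the limit. *)
Lemma demiclosed (T : E -> E) (z : nat -> E) (l : E) (M : R)
    (F : set_system nat) : ProperFilter F -> nonexpansive T ->
  (forall k, b (z k) (z k) <= M) -> dot_cvg F z l ->
  (fun k => b (z k - T (z k)) (z k - T (z k))) @ F --> (0 : R) ->
  T l = l.
Proof.
move=> FF Tne zM zl rz.
set d := l - T l; pose r k := z k - T (z k).
suff /(dot_le0_eq0 (b := b)) : b d d <= 0 by move=> /subr0_eq.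
pose C := 2 * M + 2 * b (T l) (T l).
have bound k : b d d <= 2 * Num.sqrt (b (r k) (r k) * C) - 2 * (b (z k) d - b l d).
  have cs : b (r k) (z k - T l) <= Num.sqrt (b (r k) (r k) * C).
    rewrite (le_trans (ler_norm _))// -sqrtr_sqr ler_sqrt; last first.
      rewrite mulr_ge0 ?dot_ge0//.
      have := dot_ge0 b (T l); have := dot_ge0 b (z k); have := zM k.
      by rewrite /C; lra.
    apply: (le_trans (dot_CauchySchwarz b _ _)); rewrite ler_wpM2l ?dot_ge0//.
    have := dot_ge0 b (z k + T l); have := zM k.
    by rewrite /C !dotE (dotC b (T l) (z k)); lra.
  have := Tne (z k) l; have := dot_ge0 b (r k); move: cs; rewrite /d /r !dotE.
  rewrite !(dotC b (T (z k)) (z k)) !(dotC b l) !(dotC b (T l)).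
  by lra.
have lim : (fun k => 2 * Num.sqrt (b (r k) (r k) * C) - 2 * (b (z k) d - b l d))
    @ F --> 2 * Num.sqrt (0 * C) - 2 * (b l d - b l d).
  apply: cvgB; apply: cvgMl_tmp.
    apply: continuous_cvg; first exact: sqrt_continuous.
    exact: cvgMr_tmp.
  by apply: cvgB; [exact: zl | exact: cvg_cst].
rewrite mul0r sqrtr0 subrr !mulr0 subr0 in lim.
by apply: (cvgr_to_ge lim); apply: nearW.
Qed.

Hypothesis weakly_compact : forall (z : nat -> E) (M : R) (U : set_system nat),
  UltraFilter U -> (forall k, b (z k) (z k) <= M) -> exists l, dot_cvg U z l.

(** Opial's argument: the weak limit along any ultrafilter is a fixed point,
    and two fixed points [l], [l'] arising in this way coincide because
    [b (z k) (l - l')] has a limit along the whole sequence. *)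
Theorem averaged_iterates_dot_cvg (kappa : R) (T : E -> E) (z : nat -> E)
    (p : E) : 0 < kappa -> averaged kappa T -> T p = p ->
  (forall k, z k.+1 = T (z k)) ->
  exists l, T l = l /\ dot_cvg \oo z l.
Proof.
move=> k0 Tav Tp zS; have Tne := averaged_nonexpansive k0 Tav.
have fejer q : T q = q -> forall k,
    b (z k.+1 - q) (z k.+1 - q) <= b (z k - q) (z k - q).
  by move=> Tq k; rewrite -{1 2}Tq zS; exact: Tne.
have dist_cvg q : T q = q -> cvgn (fun k => b (z k - q) (z k - q)).
  move=> Tq; apply: nonincreasing_is_cvgn.
    by apply/nonincreasing_seqP => k; exact: fejer.
  by exists 0 => _ [k _ <-]; exact: dot_ge0.
have reg : (fun k => b (z k - T (z k)) (z k - T (z k))) @ \oo --> (0 : R).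
  have [L dL] : exists L : R, (fun k => b (z k - p) (z k - p)) @ \oo --> L.
    by eexists; exact: dist_cvg Tp.
  have gap : (fun k => kappa^-1 * (b (z k - p) (z k - p)
      - b (z k.+1 - p) (z k.+1 - p))) @ \oo --> kappa^-1 * (L - L).
    apply: cvgMl_tmp; apply: cvgB; first exact: dL.
    by rewrite (cvg_shiftS (fun k => b (z k - p) (z k - p))).
  rewrite subrr mulr0 in gap.
  apply: (squeeze_cvgr _ (cvg_cst (0 : R)) gap); apply: nearW => k.
  rewrite dot_ge0 /= -ler_pdivrMl ?invr_gt0// invrK.
  by have := Tav (z k) p; rewrite Tp subrr subr0 -zS; lra.
pose M := 2 * b (z 0 - p) (z 0 - p) + 2 * b p p.
have zM k : b (z k) (z k) <= M.
  have : b (z k - p) (z k - p) <= b (z 0 - p) (z 0 - p).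
    by elim: k => // k; apply: le_trans; exact: fejer.
  have := dot_ge0 b (z k - 2%:R *: p).
  by rewrite /M !dotE !(dotC b p); lra.
(* [2 b (z k) (q - q')] is a difference of the two squared distances to [q']
   and [q], up to a constant, and both distances converge. *)
have pair_cvg q q' : T q = q -> T q' = q' -> exists c : R,
    (fun k => b (z k) (q - q')) @ \oo --> c.
  move=> Tq Tq'.
  have cq := dist_cvg _ Tq; have cq' := dist_cvg _ Tq'.
  exists (2^-1 * (limn (fun k => b (z k - q') (z k - q'))
                  - limn (fun k => b (z k - q) (z k - q)) + (b q q - b q' q'))).
  have -> : (fun k => b (z k) (q - q')) = (fun k => 2^-1 *
      (b (z k - q') (z k - q') - b (z k - q) (z k - q) + (b q q - b q' q'))).
    apply/funext => k; rewrite !dotE !(dotC b q (z k)) !(dotC b q' (z k)).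
    by field.
  apply: cvgMl_tmp; apply: cvgD; last exact: cvg_cst.
  exact: cvgB.
have limit U : UltraFilter U -> \oo `<=` U -> exists2 l, T l = l & dot_cvg U z l.
  move=> UU ooU; have [l zl] := weakly_compact UU zM; exists l => //.
  apply: (demiclosed _ Tne zM zl).
  by move=> A nA; apply: ooU; exact: (reg A nA).
have [U0 [UU0 ooU0]] := ultraFilterLemma (F := \oo) _.
have [l Tl zl] := limit U0 UU0 ooU0.
exists l; split => // y; apply: cvg_ultrafilters => U UU ooU.
have [l' Tl' zl'] := limit U UU ooU.
suff -> : l = l' by exact: zl'.
have [c zc] := pair_cvg l l' Tl Tl'.
have uniq_limit V m : UltraFilter V -> \oo `<=` V -> dot_cvg V z m ->
    b m (l - l') = c.
  move=> UV ooV zm.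
  apply: (norm_cvg_unique _ (F := (fun k => b (z k) (l - l')) @ V)).
    exact: zm.
  by move=> A cA; apply: ooV; exact: (zc A cA).
apply/subr0_eq/(dot_le0_eq0 (b := b)).
by rewrite dotDl dotNl (uniq_limit U0)// (uniq_limit U)// subrr.
Qed.

End weak_convergence_of_iterations.

(** * Subgradients and proximal points in Hilbert spaces *)

Section hilbert.
Context {R : realType} {H : hilbertType R}.
Implicit Types x y z : H.

Lemma inner_CauchySchwarz x y : `|inner x y| <= `|x| * `|y|.
Proof.
rewrite -(ler_pXn2r (n := 2)) ?nnegrE ?mulr_ge0//.
by rewrite exprMn !sqr_norm_inner -normrX ger0_norm ?sqr_ge0// dot_CauchySchwarz.
Qed.

Lemma normD_sqr x y : `|x + y| ^+ 2 = `|x| ^+ 2 + 2 * inner x y + `|y| ^+ 2.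
Proof. by rewrite !sqr_norm_inner !dotE (dotC inner y x); ring. Qed.

End hilbert.

Section subgradients.
Context {R : realType} {H : hilbertType R}.
Implicit Types (h : H -> \bar R) (p q w : H).
Local Open Scope ereal_scope.

Definition is_subgradient h p (a : H) : Prop :=
  h p \is a fin_num /\ forall q, h p + (inner a (q - p)%R)%:E <= h q.

Lemma subgradient_lower_bound h p a : is_subgradient h p a ->
  exists C D : R, forall q, (- (C * `|q|) - D)%R%:E <= h q.
Proof.
move=> [hp sub]; exists `|a|%R, (inner a p - fine (h p))%R => q.
apply: le_trans (sub q); rewrite -(fineK hp) -EFinD lee_fin dotDr dotNr /=.
by have := inner_CauchySchwarz a q; rewrite ler_norml => /andP[+ _]; lra.
Qed.

Lemma subgradient_monotone h p q a b :
  is_subgradient h p a -> is_subgradient h q b ->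
  (0 <= inner (a - b) (p - q) :> R)%R.
Proof.
move=> [hp /(_ q) aq] [hq /(_ p) bp]; move: hp hq aq bp.
move=> /fineK <- /fineK <-; rewrite -!EFinD !lee_fin !dotE; lra.
Qed.

Let objective h (gamma : R) w q := h q + ((2 * gamma)^-1 * `|q - w| ^+ 2)%R%:E.

(** Comparing [p] with [p + t (q - p)] and using convexity, the first-order term
    in [t] must be nonnegative: divide by [t] and let [t] tend to 0. *)
Lemma argmin_subgradient h (gamma : R) w p : (0 < gamma)%R ->
  proper_ereal h -> convex_ereal h -> is_argmin (objective h gamma w) p ->
  is_subgradient h p (gamma^-1 *: (w - p))%R.
Proof.
move=> g0 [hNy [x0 hx0]] hconv pmin.
have hp : h p \is a fin_num.
  rewrite fin_numE hNy; apply/eqP => hp; have := pmin x0; rewrite /objective hp.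
  rewrite addye// leye_eq.
  by case: (h x0) hx0.
split=> // q.
have [hq|/negP hq] := boolP (h q \is a fin_num); last first.
  by case: (h q) (hNy q) hq => //; rewrite leey.
have [a hpa] : exists a, h p = a%:E by exists (fine (h p)); rewrite fineK.
have [d hqd] : exists d, h q = d%:E by exists (fine (h q)); rewrite fineK.
rewrite hpa hqd -EFinD lee_fin.
set c := (2 * gamma)^-1%R.
pose slope (t : R) := (d - a + 2 * c * inner (p - w) (q - p)
                       + t * (c * `|q - p| ^+ 2))%R.
have slope_ge0 (t : R) : (0 < t < 1)%R -> (0 <= slope t)%R.
  move=> t01; have := pmin (t *: q + (1 - t) *: p)%R.
  have := hconv q p t t01; rewrite /objective -/c hpa hqd.
  case: (h (t *: q + (1 - t) *: p)%R) (hNy (t *: q + (1 - t) *: p)%R) => [s| |]// _.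
  rewrite -!EFinM -!EFinD !lee_fin => conv.
  have -> : (t *: q + (1 - t) *: p - w = (p - w) + t *: (q - p))%R.
    by rewrite scalerBl scale1r scalerBr addrCA addrAC.
  case/andP: t01 => t0 _.
  rewrite (normD_sqr (p - w)%R) normrZ exprMn dotZr (ger0_norm (ltW t0)) => low.
  rewrite -(pmulr_rge0 _ t0) /slope; lra.
have lim : slope @ 0%R^'+ --> slope 0%R.
  apply: cvgD; first exact: cvg_cst.
  by apply: cvgMr_tmp; apply: cvg_at_right_filter; exact: cvg_id.
have : (0 <= slope 0)%R.
  apply: (cvgr_to_ge lim); near=> t; apply: slope_ge0; apply/andP; split; near: t.
    exact: nbhs_right_gt.
  exact: nbhs_right_lt.
rewrite /slope mul0r addr0.
have -> : (gamma^-1 = 2 * c)%R by rewrite /c invfM mulrA divff ?mul1r.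
rewrite !dotE; lra.
Unshelve. all: by end_near. Qed.

End subgradients.

(** * Existence of proximal points *)

Section existence_of_minimizers.
Context {R : realType} {H : hilbertType R}.
Variables (h : H -> \bar R) (gamma C D : R) (w : H).
Hypotheses (gamma_gt0 : 0 < gamma) (h_proper : proper_ereal h)
  (h_convex : convex_ereal h) (h_lsc : lower_semicontinuous h)
  (h_ge : forall q, ((- (C * `|q|) - D)%:E <= h q)%E).

Let c := (2 * gamma)^-1.

Let c_gt0 : 0 < c. Proof. by rewrite invr_gt0 mulr_gt0. Qed.

Let values := [set r | exists2 q, h q \is a fin_num
                     & r = fine (h q) + c * `|q - w| ^+ 2].

Let values_has_inf : has_inf values.
Proof.
have [hNy [x0 hx0]] := h_proper; split.
  exists (fine (h x0) + c * `|x0 - w| ^+ 2), x0 => //.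
  by rewrite fin_numE hNy/= lt_eqF.
(* The minimum over [s] of [c s^2 - |C| s], with [s = |q - w|], is
   [- C^2 / (4 c)]. *)
exists (- (C ^+ 2 / (4 * c)) - `|C| * `|w| - D) => _ [q hq ->].
have := h_ge q; rewrite -{1}(fineK hq) lee_fin => low.
have tri : `|q| <= `|q - w| + `|w| by rewrite -{1}(subrK w q) ler_normD.
have Cq : C * `|q| <= `|C| * (`|q - w| + `|w|).
  rewrite (le_trans (ler_norm _))// normrM normr_id.
  by rewrite ler_wpM2l.
have : 0 <= (c * `|q - w| - `|C| / 2) ^+ 2 / c.
  by rewrite divr_ge0 ?sqr_ge0 ?ltW.
have -> : (c * `|q - w| - `|C| / 2) ^+ 2 / c =
    c * `|q - w| ^+ 2 - `|C| * `|q - w| + `|C| ^+ 2 / (4 * c).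
  by field; rewrite gt_eqF.
by rewrite real_normK ?num_real//; lra.
Qed.

Let m := inf values.

Let m_le q : h q \is a fin_num -> m <= fine (h q) + c * `|q - w| ^+ 2.
Proof. by move=> hq; apply: ge_inf; [exact: values_has_inf.2 | exists q]. Qed.

(** Strong convexity: the parallelogram identity at the midpoint, whose value is
    at least [m]. *)
Let near_minimizers_close (p q : H) (e : R) :
  h p \is a fin_num -> h q \is a fin_num ->
  fine (h p) + c * `|p - w| ^+ 2 <= m + e ->
  fine (h q) + c * `|q - w| ^+ 2 <= m + e ->
  c * `|p - q| ^+ 2 <= 4 * e.
Proof.
move=> hp hq pe qe.
set o := 2^-1 *: p + (1 - 2^-1) *: q.
have half : 0 < (2^-1 : R) < 1 by apply/andP; split; lra.
have := h_convex p q half; rewrite -/o -(fineK hp) -(fineK hq).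
have := m_le (q := o).
case: (h o) (h_proper.1 o) => [s| |]// _ /(_ isT).
rewrite -!EFinM -!EFinD !lee_fin /= => mo conv.
move: mo; have -> : o - w = 2^-1 *: ((p - w) + (q - w)).
  have -> : o = 2^-1 *: (p + q).
    by rewrite /o scalerDr; congr (_ + _ *: _); lra.
  rewrite addrACA -opprD -mulr2n -(scaler_nat 2 w) [RHS]scalerBr scalerA.
  by rewrite mulVf ?scale1r// pnatr_eq0.
have -> : p - q = (p - w) - (q - w) by rewrite opprB addrA subrK.
rewrite normrZ exprMn ger0_norm; last by lra.
rewrite !(normD_sqr (p - w)) normrN dotNr => mo.
have := c_gt0; lra.
Qed.

(** A minimizing sequence is Cauchy by strong convexity, and its limit is a
    minimizer by lower semicontinuity. *)
Lemma exists_argmin :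
  exists p, is_argmin (fun q => h q + (c * `|q - w| ^+ 2)%:E)%E p.
Proof.
have /choice[q qP] (n : nat) : exists q, h q \is a fin_num /\
    fine (h q) + c * `|q - w| ^+ 2 <= m + n.+1%:R^-1.
  have [|_ [q hq ->] /ltW qm] := inf_adherent (E := values) (eps := n.+1%:R^-1) _ values_has_inf.
    by rewrite invr_gt0 ltr0n.
  by exists q.
have q_cauchy : cvg (q @ \oo).
  apply/cauchy_cvgP; apply: cauchy_exP => e e0.
  have [N small] : exists N : nat, 4 * N.+1%:R^-1 < c * e ^+ 2.
    have ce : 0 < c * e ^+ 2 / 4 by rewrite divr_gt0// mulr_gt0// exprn_gt0.
    have [N _ /(_ N (leqnn N))] := near_infty_natSinv_lt (PosNum ce).
    by move=> lt; exists N; rewrite mulrC -ltr_pdivlMr.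
  exists (q N), N => // n /= Nn; rewrite -ball_normE /=.
  rewrite -(ltr_pXn2r (n := 2)) ?nnegrE ?(ltW e0)//.
  rewrite -(ltr_pM2l c_gt0) (le_lt_trans _ small)//.
  apply: near_minimizers_close; [exact: (qP N).1|exact: (qP n).1|exact: (qP N).2|].
  rewrite (le_trans (qP n).2)// lerD2l lef_pV2 ?posrE ?ltr0n// ler_nat ltnS.
  exact: Nn.
set p := lim (q @ \oo); exists p.
have lim_sq : (fun n => m + n.+1%:R^-1 - c * `|q n - w| ^+ 2) @ \oo -->
    m + 0 - c * `|p - w| ^+ 2.
  apply: cvgB; first by apply: cvgD; [exact: cvg_cst | exact: cvg_harmonic].
  apply: cvgMl_tmp; rewrite expr2; under eq_fun do rewrite expr2.
  have nq : (fun n => `|q n - w|) @ \oo --> `|p - w|.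
    by apply: cvg_norm; apply: cvgB => //; exact: cvg_cst.
  exact: cvgM.
have hp_le : (h p <= (m - c * `|p - w| ^+ 2)%:E)%E.
  rewrite leNgt; apply/negP => lt.
  have [a ma ap] : exists2 a, m - c * `|p - w| ^+ 2 < a & (a%:E < h p)%E.
    case: (h p) lt => [s| |]//.
      rewrite lte_fin => lt; exists ((m - c * `|p - w| ^+ 2 + s) / 2); first lra.
      by rewrite lte_fin; lra.
    by move=> _; exists (m - c * `|p - w| ^+ 2 + 1); rewrite ?ltry//; lra.
  have [V pV Va] := h_lsc ap.
  suff : a <= m + 0 - c * `|p - w| ^+ 2 by lra.
  apply: (cvgr_to_ge lim_sq).
  have : \forall n \near \oo, V (q n) by exact: (q_cauchy V pV).
  apply: filterS => n /Va; have [hq qn] := qP n.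
  by rewrite -(fineK hq) lte_fin lerBrDr => /ltW an; rewrite (le_trans _ qn)// lerD2r.
move=> q'; have hNy := h_proper.1.
have [hq'|hq'] := boolP (h q' \is a fin_num); last first.
  case: (h q') (hNy q') hq' => [//| |//] _ _.
  by rewrite addye// leey.
rewrite -(fineK hq') -EFinD; apply: le_trans (_ : m%:E <= _)%E; last first.
  by rewrite lee_fin m_le.
case: (h p) hp_le (hNy p) => [s| |]// + _.
by rewrite -EFinD !lee_fin; lra.
Qed.

Let prox_subgradient :
  is_subgradient h (prox gamma h w) (gamma^-1 *: (w - prox gamma h w)).
Proof.
apply: argmin_subgradient => //.
rewrite /prox; case: xgetP => [p _ //|none].
by have [p /none] := exists_argmin.
Qed.

(** The resolvent formula [prox_(gamma h) = (Id + gamma dh)^-1]; the inverse is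
    single-valued because the subdifferential is monotone. *)
Lemma proxP p :
  prox gamma h w = p <-> is_subgradient h p (gamma^-1 *: (w - p)).
Proof.
split=> [<-|hp]; first exact: prox_subgradient.
have := subgradient_monotone prox_subgradient hp.
rewrite -scalerBr; set d := prox gamma h w - p.
have -> : w - prox gamma h w - (w - p) = - d.
  by rewrite opprB addrC addrA subrK /d opprB.
rewrite dotZl dotNl pmulr_rge0 ?invr_gt0// oppr_ge0 => /dot_le0_eq0.
exact: subr0_eq.
Qed.

End existence_of_minimizers.

(** * Riesz representation and weak compactness *)

Section riesz.
Context {R : realType} {H : hilbertType R}.

(** The representing vector is the proximal point of [- phi] at 0, that is, the
    minimizer of [|x|^2 / 2 - phi x]. *)
Lemma riesz_representation (phi : H -> R) (C : R) :
  (forall a x y, phi (a *: x + y) = a * phi x + phi y) ->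
  (forall x, `|phi x| <= C * `|x|) ->
  exists p, forall x, phi x = inner p x.
Proof.
move=> lin bound.
have phiD x y : phi (x + y) = phi x + phi y by rewrite -[x]scale1r lin mul1r scale1r.
have phi0 : phi 0 = 0.
  by apply/normr0_eq0/le_anti; rewrite normr_ge0 andbT (le_trans (bound _))// normr0 mulr0.
have phiZ a x : phi (a *: x) = a * phi x by rewrite -[a *: x]addr0 lin phi0 addr0.
have phiN x : phi (- x) = - phi x by rewrite -scaleN1r phiZ mulN1r.
pose h x := (- phi x)%:E.
have sub : is_subgradient h (prox 1 h 0) (1^-1 *: (0 - prox 1 h 0)).
  apply/(proxP (C := C) (D := 0)) => //.
  - by split=> [x//|]; exists 0; rewrite ltry.
  - by move=> x y t _; rewrite /h -!EFinM -EFinD lee_fin phiD !phiZ; lra.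
  - move=> x a; rewrite /h lte_fin => lt.
    have C1 : 0 < `|C| + 1 by rewrite ltr_wpDl.
    exists (ball x ((- phi x - a) / (`|C| + 1))).
      by apply: nbhsx_ballx; rewrite divr_gt0// subr_gt0.
    move=> y; rewrite -ball_normE /= ltr_pdivlMr// lte_fin => xy.
    have := bound (y - x); rewrite phiD phiN (distrC y) => bd.
    have : C * `|x - y| <= `|x - y| * (`|C| + 1).
      by rewrite mulrC ler_wpM2l// (le_trans (ler_norm _))// lerDl.
    have := ler_norm (phi y - phi x); lra.
  - move=> q; rewrite lee_fin; have := bound q; have := ler_norm (phi q); lra.
set p := prox 1 h 0 in sub; exists p => x.
have le_phi y : phi y <= inner p y.
  have := sub.2 (y + p); rewrite addrK invr1 scale1r sub0r /h -EFinD lee_fin.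
  by rewrite phiD dotNl; lra.
by apply/le_anti; rewrite le_phi /=; have := le_phi (- x); rewrite phiN dotNr lerN2.
Qed.

(** The functionals [inner (x k)] converge pointwise along [U], since bounded
    real sequences do; the limit is linear and bounded, hence represented. *)
Lemma bounded_weak_limit (U : set_system nat) (x : nat -> H) (M : R) :
  UltraFilter U -> (forall k, `|x k| <= M) -> exists l, dot_cvg inner U x l.
Proof.
move=> UU xM.
have bound y k : `|inner (x k) y| <= M * `|y|.
  by rewrite (le_trans (inner_CauchySchwarz _ _))// ler_wpM2r.
have lim_ex y : exists l : R, (fun k => inner (x k) y) @ U --> l.
  have : compact `[- (M * `|y|), M * `|y|]%classic by exact: segment_compact.
  have seg : ((fun k => inner (x k) y) @ U) `[- (M * `|y|), M * `|y|]%classic.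
    by apply: nearW => k /=; rewrite in_itv/= -ler_norml.
  move=> /(_ _ _ seg)[l [_ cl]]; exists l => A lA.
  have [//|UnA] := in_ultra_setVsetC ((fun k => inner (x k) y) @^-1` A) UU.
  have [z [nAz Az]] := cl (~` A) A UnA lA.
  by [].
have /choice[phi phiP] := lim_ex.
have [p pP] : exists p, forall y, phi y = inner p y.
  apply: (riesz_representation (C := M)) => [a y z|y].
    apply: (norm_cvg_unique _ (F := (fun k => inner (x k) (a *: y + z)) @ U)).
      exact: phiP.
    have -> : (fun k => inner (x k) (a *: y + z)) =
        (fun k => a * inner (x k) y + inner (x k) z).
      by apply/funext => k; rewrite dotDr dotZr.
    by apply: cvgD; [apply: cvgMl_tmp|]; exact: phiP.
  rewrite ler_norml; apply/andP; split.
    by apply: (cvgr_to_ge (phiP y)); apply: nearW => k;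
      have := bound y k; rewrite ler_norml => /andP[].
  by apply: (cvgr_to_le (phiP y)); apply: nearW => k;
      have := bound y k; rewrite ler_norml => /andP[].
by exists p => y; rewrite -pP.
Qed.

End riesz.

(** * Conjugates, adjoints and saddle points *)

Section fenchel_conjugate.
Context {R : realType} {H : hilbertType R} (f : H -> \bar R).
Hypothesis f_proper : proper_ereal f.
Local Open Scope ereal_scope.

Lemma fenchel_neqNy v : fenchel f v != -oo.
Proof.
have [fNy [x fx]] := f_proper.
have : (inner v x)%:E - f x <= fenchel f v by apply: ereal_sup_ubound; exists x.
case: (f x) fx (fNy x) => [r| |]// _ _; apply: contraTneq => ->.
by rewrite -EFinB leeNy_eq.
Qed.

Lemma fenchel_convex : convex_ereal (fenchel f).
Proof.
have [fNy _] := f_proper.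
move=> v v' t /andP[t0 t1]; apply: ge_ereal_sup => _ [x _ <-].
have le1 : (inner v x)%:E - f x <= fenchel f v.
  by apply: ereal_sup_ubound; exists x.
have le2 : (inner v' x)%:E - f x <= fenchel f v'.
  by apply: ereal_sup_ubound; exists x.
case: (f x) (fNy x) le1 le2 => [r| |]// _ le1 le2; last by rewrite addeNy leNye.
have t0' : 0 <= t%:E by rewrite lee_fin ltW.
have t1' : 0 <= (1 - t)%R%:E by rewrite lee_fin subr_ge0 ltW.
apply: le_trans (leeD (lee_wpmul2l t0' le1) (lee_wpmul2l t1' le2)).
by rewrite -!EFinB -!EFinM -EFinD lee_fin dotDl !dotZl; lra.
Qed.

(** A conjugate is a supremum of continuous affine functions. *)
Lemma fenchel_lsc : lower_semicontinuous (fenchel f).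
Proof.
move=> v a /ereal_sup_gt[_ [x _ <-]].
case fx : (f x) => [r| |] //=; last first.
  by move: (f_proper.1 x); rewrite fx.
rewrite -EFinB lte_fin => lt.
have x1 : (0 < `|x| + 1)%R by rewrite ltr_wpDl.
exists (ball v ((inner v x - r - a) / (`|x| + 1))%R).
  by apply: nbhsx_ballx; rewrite divr_gt0// subr_gt0.
move=> y; rewrite -ball_normE /= ltr_pdivlMr// => vy.
apply: (@lt_le_trans _ _ ((inner y x)%:E - f x)); last first.
  by apply: ereal_sup_ubound; exists x.
rewrite fx -EFinB lte_fin.
have := le_trans (ler_norm _) (inner_CauchySchwarz (v - y)%R x).
by rewrite dotDl dotNl; have := normr_ge0 (v - y)%R; lra.
Qed.

End fenchel_conjugate.

Section bounded_operators.
Context {R : realType} {H1 H2 : hilbertType R} (K : {linear H1 -> H2}).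
Hypothesis K_bounded : bounded_near K (nbhs (0 : H1)).

Let K_lipschitz : exists2 r, 0 < r & forall x, `|K x| <= r * `|x|.
Proof. exact: (pinfty_ex_gt0 ((linear_boundedP K).1 K_bounded)). Qed.

Lemma le_opnorm x : `|K x| <= opnorm K * `|x|.
Proof.
have [r r0 Kr] := K_lipschitz.
have [->|x0] := eqVneq x 0; first by rewrite linear0 !normr0 mulr0.
have nx : 0 < `|x| by rewrite normr_gt0.
rewrite -ler_pdivrMr// mulrC -[X in X * _](ger0_norm (x := `|x|^-1)) ?invr_ge0//.
rewrite -normrZ -linearZ /=; apply: ub_le_sup.
  exists r => _ [y /= y1 <-]; rewrite (le_trans (Kr y))//.
  by rewrite -[leRHS]mulr1 ler_pM2l.
exists (`|x|^-1 *: x) => //=.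
by rewrite normrZ ger0_norm ?invr_ge0// mulVf// gt_eqF.
Qed.

Lemma adjointP v x : inner (K x) v = inner x (adjoint K v).
Proof.
have [r r0 Kr] := K_lipschitz.
have [p pP] : exists p, forall y, inner (K y) v = inner p y.
  apply: (riesz_representation (C := r * `|v|)) => [a y z|y].
    by rewrite linearP dotDl dotZl.
  by rewrite (le_trans (inner_CauchySchwarz _ _))// mulrAC ler_wpM2r.
move: x; rewrite /adjoint; case: xgetP => [w _ //|none].
by exfalso; apply: (none p) => y; rewrite pP dotC.
Qed.

End bounded_operators.

Section saddle_points.
Context {R : realType} {H1 H2 : hilbertType R}.
Variables (g : H1 -> \bar R) (f : H2 -> \bar R) (K : {linear H1 -> H2}).
Hypotheses (g_proper : proper_ereal g) (f_proper : proper_ereal f)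
  (K_bounded : bounded_near K (nbhs (0 : H1))).
Local Open Scope ereal_scope.

Lemma saddle_subgradients us vs : is_saddle g f K us vs <->
  is_subgradient g us (- adjoint K vs)%R /\ is_subgradient (fenchel f) vs (K us).
Proof.
have gNy := g_proper.1; have fNy := fenchel_neqNy f_proper.
split=> [[gus fvs sad]|[[gfin gsub] [ffin fsub]]].
  have gfin : g us \is a fin_num by rewrite fin_numE gNy/= lt_eqF.
  have ffin : fenchel f vs \is a fin_num by rewrite fin_numE fNy/= lt_eqF.
  split; split => // q.
    have := (sad q vs).2; rewrite /lagrangian -(fineK gfin) -(fineK ffin).
    case: (g q) (gNy q) => [r| |]// _; last by move=> _; rewrite leey.
    rewrite -!EFinB -!EFinD !lee_fin dotNl dotDr dotNr.
    by rewrite !(dotC inner (adjoint _ _)) -!(adjointP K_bounded); lra.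
  have := (sad us q).1; rewrite /lagrangian -(fineK gfin) -(fineK ffin).
  case: (fenchel f q) (fNy q) => [r| |]// _; last by move=> _; rewrite leey.
  by rewrite -!EFinB -!EFinD !lee_fin dotDr dotNr; lra.
split; [by rewrite ltey_eq gfin | by rewrite ltey_eq ffin |] => u v.
rewrite /lagrangian; split.
  have := fsub v; rewrite -(fineK gfin) -(fineK ffin).
  case: (fenchel f v) (fNy v) => [r| |]// _.
    by rewrite -!EFinB -!EFinD !lee_fin dotDr dotNr; lra.
  by move=> _; rewrite addeNy leNye.
have := gsub u; rewrite -(fineK gfin) -(fineK ffin).
case: (g u) (gNy u) => [r| |]// _; last by move=> _; rewrite addye// leey.
rewrite -!EFinB -!EFinD !lee_fin dotNl dotDr dotNr !(dotC inner (adjoint _ _)).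
by rewrite -!(adjointP K_bounded); lra.
Qed.

End saddle_points.

(** * The primal-dual step *)

Section primal_dual_algorithm.
Context {R : realType} {H1 H2 : hilbertType R}.
Variables (g : H1 -> \bar R) (phi : H2 -> \bar R) (K : {linear H1 -> H2})
  (Kt : H2 -> H1) (L tau sigma : R).
Hypotheses (Kt_adjoint : forall v x, inner (K x) v = inner x (Kt v))
  (K_le : forall x, `|K x| <= L * `|x|)
  (tau_gt0 : 0 < tau) (sigma_gt0 : 0 < sigma) (step : tau * sigma * L ^+ 2 < 1).

(** The form of [M (u, v) = (u / tau + sigma K^* K u - K^* v, v / sigma - K u)].
    If a step sends [z] to [z+] and [y] is the proximal point computed for its
    second component, then [M (z - z+)] belongs to the monotone operator
    [(u, v) |-> (dg u + K^* v, dphi v - K u)] at the point [(u+, y)]. *)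
Definition pd_form (z z' : H1 * H2) : R :=
  tau^-1 * inner z.1 z'.1
  + sigma^-1 * inner (z.2 - sigma *: K z.1) (z'.2 - sigma *: K z'.1).

Let pd_formC z z' : pd_form z z' = (-1) ^+ false * idfun (pd_form z' z).
Proof. by rewrite expr0 mul1r /= /pd_form [LHS]/= (dotC inner z.1) (dotC inner (z.2 - _)). Qed.

Let pd_formDl z' : zmod_morphism (pd_form^~ z').
Proof.
move=> x y; rewrite /pd_form /= (linearB K) (scalerBr sigma) dotDl dotNl.
have -> : x.2 - y.2 - (sigma *: K x.1 - sigma *: K y.1) =
    (x.2 - sigma *: K x.1) - (y.2 - sigma *: K y.1).
  by rewrite opprD addrACA -opprD.
by rewrite (dotDl inner _ (x.2 - _)) dotNl; ring.
Qed.

Let pd_formZl z' : scalable_for *%R (pd_form^~ z').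
Proof.
move=> a x; rewrite /pd_form /= (linearZ_LR K) scalerA (mulrC sigma) -scalerA -scalerBr !dotZl.
by ring.
Qed.

Let pd_formDr z : zmod_morphism (pd_form z).
Proof. by move=> x y; rewrite pd_formC pd_formDl !(pd_formC z) !expr0 !mul1r. Qed.

Let pd_formZr z : scalable_for *%R (pd_form z).
Proof. by move=> a x; rewrite pd_formC pd_formZl (pd_formC z) !expr0 !mul1r. Qed.

Let pd_form_gt0 z : z != 0 -> 0 < pd_form z z.
Proof.
move=> z0; have ti : 0 < tau^-1 by rewrite invr_gt0.
have si : 0 < sigma^-1 by rewrite invr_gt0.
have [z10|z1] := eqVneq z.1 0.
  have z2 : z.2 != 0.
    by apply: contra z0 => /eqP z20; rewrite [z]surjective_pairing z10 z20.
  rewrite /pd_form z10 (linear0 K) scaler0 subr0 linear0l mulr0 add0r.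
  by rewrite mulr_gt0// neq0_dnorm_gt0.
by rewrite ltr_wpDr ?mulr_gt0 ?neq0_dnorm_gt0// mulr_ge0 ?dot_ge0// ltW.
Qed.

HB.instance Definition _ := isBilinear.Build R (H1 * H2)%type (H1 * H2)%type R
  *%R *%R pd_form pd_formDl pd_formDr pd_formZl pd_formZr.
HB.instance Definition _ :=
  isHermitianSesquilinear.Build R (H1 * H2)%type false idfun pd_form pd_formC.
HB.instance Definition _ :=
  isDotProduct.Build R (H1 * H2)%type pd_form pd_form_gt0.

(** What makes weak convergence for [pd_form] imply weak convergence of both
    components. *)
Lemma dual_represented_by_pd_form (p1 : H1) (p2 : H2) : exists y,
  forall z, pd_form z y = inner p1 z.1 + inner p2 z.2.
Proof.
pose y1 := tau *: (p1 + sigma *: Kt p2).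
exists (y1, sigma *: p2 + sigma *: K y1) => z; rewrite /pd_form /= addrK.
rewrite /y1 !dotZr !mulKf ?gt_eqF// dotDr dotZr dotDl dotNl dotZl Kt_adjoint.
by rewrite (dotC inner p1) (dotC inner p2); ring.
Qed.

(** The form bounds [u] and [v - sigma K u], whose weak limits determine that
    of [v]. *)
Lemma pd_form_weakly_compact (z : nat -> H1 * H2) (M : R) (U : set_system nat) :
  UltraFilter U -> (forall k, pd_form (z k) (z k) <= M) ->
  exists l, dot_cvg pd_form U z l.
Proof.
move=> UU zM.
have ti : 0 < tau^-1 by rewrite invr_gt0.
have si : 0 < sigma^-1 by rewrite invr_gt0.
pose w k := (z k).2 - sigma *: K (z k).1.
have M0 : 0 <= M by apply: le_trans (zM 0); exact: dot_ge0.
have uM k : `|(z k).1| <= Num.sqrt (tau * M).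
  rewrite -(ler_pXn2r (n := 2)) ?nnegrE// sqr_sqrtr ?mulr_ge0 ?(ltW tau_gt0)//.
  rewrite -ler_pdivrMl// sqr_norm_inner; apply: le_trans (zM k).
  by rewrite lerDl mulr_ge0 ?dot_ge0// ltW.
have wM k : `|w k| <= Num.sqrt (sigma * M).
  rewrite -(ler_pXn2r (n := 2)) ?nnegrE// sqr_sqrtr ?mulr_ge0 ?(ltW sigma_gt0)//.
  rewrite -ler_pdivrMl// sqr_norm_inner; apply: le_trans (zM k).
  by rewrite lerDr mulr_ge0 ?dot_ge0// ltW.
have [ul ul_lim] := bounded_weak_limit UU uM.
have [wl wl_lim] := bounded_weak_limit UU wM.
exists (ul, wl + sigma *: K ul) => y.
have lE : tau^-1 * inner ul y.1 + sigma^-1 * inner wl (y.2 - sigma *: K y.1) =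
    pd_form (ul, wl + sigma *: K ul) y.
  by rewrite /pd_form /= addrK.
have : (fun k => pd_form (z k) y) @ U -->
    tau^-1 * inner ul y.1 + sigma^-1 * inner wl (y.2 - sigma *: K y.1).
  by apply: cvgD; apply: cvgMl_tmp; [exact: ul_lim | exact: wl_lim].
by rewrite lE.
Qed.

Definition pd_step (z : H1 * H2) : H1 * H2 :=
  let u := prox tau g (z.1 - tau *: Kt z.2) in
  (u, prox sigma phi (z.2 + sigma *: K u) + sigma *: (K u - K z.1)).

Hypothesis g_proxP : forall w p,
  prox tau g w = p <-> is_subgradient g p (tau^-1 *: (w - p)).
Hypothesis phi_proxP : forall w p,
  prox sigma phi w = p <-> is_subgradient phi p (sigma^-1 *: (w - p)).

Let g_prox w := (g_proxP w _).1 erefl.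
Let phi_prox w := (phi_proxP w _).1 erefl.

Let delta := tau^-1 - sigma * L ^+ 2.

Let delta_gt0 : 0 < delta.
Proof.
have -> : delta = tau^-1 * (1 - tau * sigma * L ^+ 2).
  by rewrite /delta; field; rewrite gt_eqF.
by rewrite mulr_gt0 ?invr_gt0// subr_gt0.
Qed.

(** The difference of the two sides is twice the sum of the two monotonicity
    terms [mono1] and [mono2]. *)
Lemma pd_step_descent (z z' : H1 * H2)
    (du := (z.1 - z'.1) - ((pd_step z).1 - (pd_step z').1))
    (dv := (z.2 - z'.2) - ((pd_step z).2 - (pd_step z').2)) :
  pd_form (pd_step z - pd_step z') (pd_step z - pd_step z')
    + tau^-1 * `|du| ^+ 2 - sigma * `|K du| ^+ 2
    + sigma^-1 * `|dv - (2 * sigma) *: K du| ^+ 2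
  <= pd_form (z - z') (z - z').
Proof.
have tau0 : tau != 0 by rewrite gt_eqF.
have sigma0 : sigma != 0 by rewrite gt_eqF.
pose u := prox tau g (z.1 - tau *: Kt z.2).
pose u' := prox tau g (z'.1 - tau *: Kt z'.2).
pose y := prox sigma phi (z.2 + sigma *: K u).
pose y' := prox sigma phi (z'.2 + sigma *: K u').
pose a := z.1 - z'.1; pose c := z.2 - z'.2; pose d := u - u'; pose e := y - y'.
have mono1 : 0 <= tau^-1 * inner (a - d) d - inner c (K d).
  have := subgradient_monotone (g_prox (z.1 - tau *: Kt z.2))
    (g_prox (z'.1 - tau *: Kt z'.2)).
  rewrite -/u -/u' => /le_trans; apply; rewrite le_eqVlt; apply/predU1P; left.
  rewrite -/d !dotDl !dotNl !dotZl !dotDl !dotNl !dotZl.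
  rewrite !(dotC inner (Kt _)) -!Kt_adjoint !(dotC inner (K _)).
  by field.
have mono2 : 0 <= sigma^-1 * inner (c - e) e + inner (K d) e.
  have := subgradient_monotone (phi_prox (z.2 + sigma *: K u))
    (phi_prox (z'.2 + sigma *: K u')).
  rewrite -/y -/y' => /le_trans; apply; rewrite le_eqVlt; apply/predU1P; left.
  rewrite -/e !dotDl !dotNl !dotZl !dotDl !dotNl !dotZl (linearB K) !dotDl !dotNl.
  by field.
have step2 : (pd_step z).2 - (pd_step z').2 = e + sigma *: (K d - K a).
  rewrite /pd_step /= -/u -/u' -/y -/y' opprD addrACA -/e; congr (_ + _).
  by rewrite -scalerBr !(linearB K) opprD addrACA -opprD.
have -> : pd_form (pd_step z - pd_step z') (pd_step z - pd_step z') =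
    tau^-1 * `|d| ^+ 2 + sigma^-1 * `|e - sigma *: K a| ^+ 2.
  rewrite /pd_form -!sqr_norm_inner; congr (_ + _ * `|_| ^+ 2).
  rewrite [(pd_step z - pd_step z').2]step2 -addrA; congr (_ + _).
  by rewrite -scalerBr addrAC subrr add0r scalerN.
have -> : pd_form (z - z') (z - z') =
    tau^-1 * `|a| ^+ 2 + sigma^-1 * `|c - sigma *: K a| ^+ 2.
  by rewrite /pd_form -!sqr_norm_inner.
have -> : dv - (2 * sigma) *: K du = (c - e) - sigma *: (K a - K d).
  rewrite /dv step2 /du -/a -/c (linearB K a) -[_.1 - _.1]/d.
  rewrite -(opprB (K a) (K d)) scalerN -scalerA scaler_nat mulr2n.
  set S := sigma *: _; rewrite (opprD e) opprK (opprD S) (addrA c).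
  by rewrite (addrA (c - e + S)) !addrK.
have -> : du = a - d by [].
have Kad : K (a - d) = K a - K d by exact: linearB.
rewrite Kad !sqr_norm_inner.
move: mono1 mono2; clearbody a c d e.
move: (K a) (K d) => Ka Kd mono1 mono2.
rewrite -subr_ge0.
have -> : tau^-1 * inner a a + sigma^-1 * inner (c - sigma *: Ka) (c - sigma *: Ka)
  - (tau^-1 * inner d d + sigma^-1 * inner (e - sigma *: Ka) (e - sigma *: Ka)
     + tau^-1 * inner (a - d) (a - d) - sigma * inner (Ka - Kd) (Ka - Kd)
     + sigma^-1 * inner (c - e - sigma *: (Ka - Kd)) (c - e - sigma *: (Ka - Kd)))
  = 2 * (tau^-1 * inner (a - d) d - inner c Kd)
    + 2 * (sigma^-1 * inner (c - e) e + inner Kd e).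
  rewrite !dotE (dotC inner d a) (dotC inner e c) !(dotC inner Ka) !(dotC inner Kd).
  by rewrite ?(dotC inner Kd Ka); field; apply/andP.
by apply: addr_ge0; exact: mulr_ge0.
Qed.

(** The condition [tau sigma L^2 < 1] makes [delta = 1 / tau - sigma L^2]
    positive, so that the decrease in [pd_step_descent] is at least
    [delta |du|^2 + |dv - 2 sigma K du|^2 / sigma], which controls [pd_form]. *)
Lemma pd_step_averaged : exists2 kappa, 0 < kappa & averaged pd_form kappa pd_step.
Proof.
have ti : 0 < tau^-1 by rewrite invr_gt0.
have si : 0 < sigma^-1 by rewrite invr_gt0.
pose P := tau^-1 + 2 * sigma * L ^+ 2.
have P0 : 0 < P by rewrite ltr_wpDr// mulr_ge0 ?sqr_ge0// mulr_ge0// ltW.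
(* [kappa] has to satisfy [kappa P <= delta] for the [du] part, and
   [2 kappa <= 1] for the other part, the factors [2] coming from [young]. *)
pose kappa := delta / (P + 2 * delta).
have den : 0 < P + 2 * delta by rewrite addr_gt0// mulr_gt0.
have k0 : 0 < kappa by rewrite divr_gt0.
have kP : kappa * P <= delta.
  by rewrite /kappa mulrAC ler_pdivrMr// ler_pM2l// lerDl mulr_ge0// ltW.
have k2 : 2 * kappa <= 1.
  by rewrite /kappa mulrA ler_pdivrMr// mul1r lerDr ltW.
exists kappa => // z z'.
have := pd_step_descent z z'.
set du := (z.1 - z'.1) - _; set dv := (z.2 - z'.2) - _.
have -> : (z - pd_step z) - (z' - pd_step z') = (du, dv).
  by rewrite opprD addrACA -opprD.
suff main : pd_form (pd_step z - pd_step z') (pd_step z - pd_step z') +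
    tau^-1 * `|du| ^+ 2 - sigma * `|K du| ^+ 2 +
    sigma^-1 * `|dv - (2 * sigma) *: K du| ^+ 2 <= pd_form (z - z') (z - z') ->
    pd_form (pd_step z - pd_step z') (pd_step z - pd_step z') +
    kappa * pd_form (du, dv) (du, dv) <= pd_form (z - z') (z - z') by exact: main.
have -> : pd_form (du, dv) (du, dv) =
    tau^-1 * `|du| ^+ 2 + sigma^-1 * `|dv - sigma *: K du| ^+ 2.
  by rewrite /pd_form /= -!sqr_norm_inner.
set r := dv - (2 * sigma) *: K du.
have -> : dv - sigma *: K du = r + sigma *: K du.
  by rewrite /r mulr_natl mulr2n scalerDl opprD addrA subrK.
have Kdu : `|K du| ^+ 2 <= L ^+ 2 * `|du| ^+ 2.
  rewrite -exprMn ler_pXn2r ?nnegrE// (le_trans _ (K_le du))//.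
have young : `|r + sigma *: K du| ^+ 2 <= 2 * `|r| ^+ 2 + 2 * sigma ^+ 2 * `|K du| ^+ 2.
  have := sqr_ge0 `|r - sigma *: K du|.
  rewrite !(normD_sqr r) normrN dotNr normrZ exprMn real_normK ?num_real//.
  by lra.
have h1 : kappa * (sigma^-1 * `|r + sigma *: K du| ^+ 2) <=
    2 * kappa * (sigma^-1 * `|r| ^+ 2) + 2 * kappa * sigma * `|K du| ^+ 2.
  have -> : 2 * kappa * (sigma^-1 * `|r| ^+ 2) + 2 * kappa * sigma * `|K du| ^+ 2
      = kappa * (sigma^-1 * (2 * `|r| ^+ 2 + 2 * sigma ^+ 2 * `|K du| ^+ 2)).
    by field; rewrite gt_eqF.
  by rewrite !ler_pM2l.
have h2 : 2 * kappa * sigma * `|K du| ^+ 2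
    <= 2 * kappa * sigma * (L ^+ 2 * `|du| ^+ 2).
  by rewrite ler_wpM2l// mulr_ge0 ?(ltW sigma_gt0)// mulr_ge0// ltW.
have h3 : kappa * P * `|du| ^+ 2 <= delta * `|du| ^+ 2.
  by rewrite ler_wpM2r// sqr_ge0.
have h4 : 2 * kappa * (sigma^-1 * `|r| ^+ 2) <= sigma^-1 * `|r| ^+ 2.
  by rewrite ler_piMl// mulr_ge0 ?sqr_ge0// ltW.
have h5 : sigma * `|K du| ^+ 2 <= sigma * (L ^+ 2 * `|du| ^+ 2).
  by rewrite ler_pM2l.
by move: h3; rewrite /P /delta; lra.
Qed.

Lemma pd_step_fixed u v : pd_step (u, v) = (u, v) <->
  is_subgradient g u (- Kt v) /\ is_subgradient phi v (K u).
Proof.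
have tau0 : tau != 0 by rewrite gt_eqF.
have sigma0 : sigma != 0 by rewrite gt_eqF.
have g_dir : tau^-1 *: ((u - tau *: Kt v) - u) = - Kt v.
  by rewrite addrC addrA addNr add0r scalerN scalerA mulVf// scale1r.
have phi_dir : sigma^-1 *: ((v + sigma *: K u) - v) = K u.
  by rewrite addrC addKr scalerA mulVf// scale1r.
split=> [[ug]|[gsub phisub]].
  rewrite /= ug subrr scaler0 addr0 => vphi; split.
    by rewrite -g_dir -{1 3}ug; exact: g_prox.
  by rewrite -phi_dir -{1 3}vphi; exact: phi_prox.
have ug : prox tau g (u - tau *: Kt v) = u by apply/g_proxP; rewrite g_dir.
rewrite /pd_step /= ug subrr scaler0 addr0; congr (_, _).
by apply/phi_proxP; rewrite phi_dir.
Qed.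

Lemma continuous_linear_pd_form (psi : {linear (H1 * H2)%type -> R^o}) :
  continuous psi -> exists y, forall z, psi z = pd_form z y.
Proof.
move=> /linear_bounded_continuous/linear_boundedP/pinfty_ex_gt0[C C0 psiC].
have [p1 p1E] : exists p1 : H1, forall x, psi (x, 0) = inner p1 x.
  apply: (riesz_representation (C := C)) => [a x y|x].
    by rewrite -[a * _]/(a *: _) -linearP; congr (psi (_, _)); rewrite /= scaler0 addr0.
  rewrite (le_trans (psiC _))// ler_pM2l// prod_normE /= normr0.
  by rewrite ge_max lexx /=.
have [p2 p2E] : exists p2 : H2, forall x, psi (0, x) = inner p2 x.
  apply: (riesz_representation (C := C)) => [a x y|x].
    by rewrite -[a * _]/(a *: _) -linearP; congr (psi (_, _)); rewrite /= scaler0 addr0.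
  rewrite (le_trans (psiC _))// ler_pM2l// prod_normE /= normr0.
  by rewrite ge_max lexx andbT.
have [y yE] := dual_represented_by_pd_form p1 p2; exists y => -[u v].
rewrite yE /= -p1E -p2E -[RHS](linearD psi); congr (psi (_, _)) => /=.
  by rewrite addr0.
by rewrite add0r.
Qed.

Theorem pd_iterates_weakly_cvg (z : nat -> H1 * H2) (us : H1) (vs : H2) :
  (forall k, z k.+1 = pd_step (z k)) ->
  is_subgradient g us (- Kt vs) -> is_subgradient phi vs (K us) ->
  exists u v, [/\ is_subgradient g u (- Kt v), is_subgradient phi v (K u)
               & weakly_cvg z (u, v)].
Proof.
move=> zS gs phis.
have [kappa k0 Tav] := pd_step_averaged.
have Ts : pd_step (us, vs) = (us, vs) by apply/pd_step_fixed.
have [[u v] [Tuv zuv]] :=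
  averaged_iterates_dot_cvg pd_form_weakly_compact k0 Tav Ts zS.
have [gu phiv] := (pd_step_fixed u v).1 Tuv.
exists u, v; split=> // psi /continuous_linear_pd_form[y yE].
rewrite yE; under eq_fun do rewrite yE.
exact: zuv.
Qed.

End primal_dual_algorithm.

(** * Convergence of the algorithm *)

Theorem theorem4 (R : realType) (H1 H2 : hilbertType R)
  (g : H1 -> \bar R) (f : H2 -> \bar R) (K : {linear H1 -> H2})
  (tau sigma : R) (u : nat -> H1) (v : nat -> H2) (u0 : H1) (v0 : H2)
  (g_proper : proper_ereal g) (g_convex : convex_ereal g)
  (g_lsc : lower_semicontinuous g)
  (f_proper : proper_ereal f) (f_convex : convex_ereal f)
  (f_lsc : lower_semicontinuous f)
  (K_bounded : bounded_near K (nbhs (0 : H1)))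
  (saddle_exists : exists (us : H1) (vs : H2), is_saddle g f K us vs)
  (tau_gt0 : 0 < tau) (sigma_gt0 : 0 < sigma)
  (step : tau * sigma * opnorm K ^+ 2 < 1)
  (u_init : u 0%N = u0) (v_init : v 0%N = v0)
  (u_step : forall k : nat,
     u k.+1 = prox tau g (u k - tau *: adjoint K (v k)))
  (v_step : forall k : nat,
     v k.+1 = prox sigma (fenchel f) (v k + sigma *: K (u k.+1))
              + sigma *: (K (u k.+1) - K (u k))) :
  exists (us : H1) (vs : H2), is_saddle g f K us vs /\
    weakly_cvg (fun k => (u k, v k)) (us, vs).
Proof.
have [us [vs saddle]] := saddle_exists.
have [gs fs] := (saddle_subgradients g_proper f_proper K_bounded us vs).1 saddle.
have f'_proper : proper_ereal (fenchel f).
  by split; [exact: fenchel_neqNy | exists vs; case: saddle].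
have f'_convex := fenchel_convex f_proper.
have f'_lsc := fenchel_lsc f_proper.
(* The saddle point supplies affine minorants, hence the existence of the
   proximal points. *)
have [C [D g_ge]] := subgradient_lower_bound gs.
have [C' [D' f'_ge]] := subgradient_lower_bound fs.
have zS k : (u k.+1, v k.+1) =
    pd_step g (fenchel f) K (adjoint K) tau sigma (u k, v k).
  by rewrite /pd_step /= -u_step -v_step.
have [ul [vl [gl fl uv_lim]]] := pd_iterates_weakly_cvg
  (adjointP K_bounded) (le_opnorm K_bounded) tau_gt0 sigma_gt0 step
  (fun w p => proxP w tau_gt0 g_proper g_convex g_lsc g_ge p)
  (fun w p => proxP w sigma_gt0 f'_proper f'_convex f'_lsc f'_ge p)
  (z := fun k => (u k, v k)) zS gs fs.
exists ul, vl; split=> //.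
exact/(saddle_subgradients g_proper f_proper K_bounded).
Qed.
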